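(* Let $K\ge 1$ and let $M_1,\dots,M_K,N_1,\dots,N_K$ be positive integers. For generic channel matrices $(\mathbf{H}_{kj})_{k,j=1}^K$, $\mathbf{H}_{kj}\in\mathbb{C}^{N_k\times M_j}$ (no channel extension), every tuple of degrees of freedom $(d_1,\dots,d_K)$ that is achievable through linear interference alignment over $(\mathbf{H}_{kj})$ satisfies all of the following inequalities: $$\min\{M_k,N_k\}\ \ge\ d_k\qquad\text{for all } k;$$ $$\max\{M_k,N_j\}\ \ge\ d_k+d_j\qquad\text{for all } k\neq j;$$ $$\sum_{k:\,(k,j)\in\mathcal{I}}(M_k-d_k)d_k+\sum_{j:\,(k,j)\in\mathcal{I}}(N_j-d_j)d_j\ \ge\ \sum_{(k,j)\in\mathcal{I}}d_kd_j\qquad\text{for all }\mathcal{I}\subseteq\mathcal{J},$$ where $\mathcal{J}=\{(k,j)\mid 1\le k\neq j\le K\}$.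
   Context: Setting: a $K$-user flat fading MIMO interference channel in which transmitter $k$ has $M_k$ antennas and receiver $k$ has $N_k$ antennas. The channel from transmitter $j$ to receiver $k$ is a complex matrix $\mathbf{H}_{kj}$ of size $N_k\times M_j$. Achievability through linear interference alignment: for given channel matrices $(\mathbf{H}_{kj})_{k,j=1}^K$, a tuple $(d_1,\dots,d_K)$ of nonnegative integers (numbers of data streams) is achievable through linear interference alignment (without channel extension) if there exist matrices $\mathbf{V}_k\in\mathbb{C}^{M_k\times d_k}$ and $\mathbf{U}_k\in\mathbb{C}^{N_k\times d_k}$, $k=1,\dots,K$, such that $$\mathbf{U}_k^H\mathbf{H}_{kj}\mathbf{V}_j=\mathbf{0}\ \text{ for all } j\neq k,\qquad \operatorname{rank}(\mathbf{U}_k^H\mathbf{H}_{kk}\mathbf{V}_k)=d_k\ \text{ for all } k,$$ where $(\cdot)^H$ is the conjugate transpose. Generic: a property holds for generic channel matrices if it holds for all $(\mathbf{H}_{kj})_{k,j}$ in some nonempty Zariski open subset of $\prod_{k,j=1}^K\mathbb{C}^{N_k\times M_j}$ (in particular, almost surely when the entries are drawn from a continuous probability distribution). Summation convention: $\sum_{k:(k,j)\in\mathcal{I}}$ is the sum over the set of all $k$ such that $(k,j)\in\mathcal{I}$ for some $j$ (each such $k$ counted once); $\sum_{j:(k,j)\in\mathcal{I}}$ is the sum over the set of all $j$ such that $(k,j)\in\mathcal{I}$ for some $k$ (each such $j$ counted once). *)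

(* Defs.v *)
(* The complex field is R[i], for R : realType. *)
From HB Require Import structures.
From mathcomp Require Import all_boot all_order all_algebra.
From mathcomp Require Import spectral.
From mathcomp Require Import reals.
From mathcomp Require Import complex.
From mathcomp Require Import mpoly.

Set Implicit Arguments.
Unset Strict Implicit.
Unset Printing Implicit Defensive.

Import Order.TTheory GRing.Theory Num.Theory.
Local Open Scope ring_scope.
Local Open Scope sesquilinear_scope.
Local Open Scope complex_scope.

(* H k j is the channel from transmitter j (M j antennas) to receiver k (N k
   antennas). *)
Definition channels (R : realType) (K : nat) (M N : 'I_K -> nat) : Type :=
  forall k j : 'I_K, 'M[R[i]]_(N k, M j).

(* Index set of the scalar coordinates of the affine space of all channels:
   ((k, j), (a, b)) stands for the entry (a, b) of H k j. *)
Definition entry (K : nat) (M N : 'I_K -> nat) : finType :=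
  {kj : 'I_K * 'I_K & ('I_(N kj.1) * 'I_(M kj.2))%type}.

Definition coords (R : realType) (K : nat) (M N : 'I_K -> nat)
    (H : channels R M N) (i : 'I_#|entry M N|) : R[i] :=
  let e := enum_val i in
  H (tag e).1 (tag e).2 (tagged e).1 (tagged e).2.

Definition zariski_closed (R : realType) (K : nat) (M N : 'I_K -> nat)
    (Z : channels R M N -> Prop) : Prop :=
  exists S : {mpoly R[i][#|entry M N|]} -> Prop,
    forall H, Z H <-> (forall p, S p -> p.@[coords H] = 0).

Definition zariski_open (R : realType) (K : nat) (M N : 'I_K -> nat)
    (U : channels R M N -> Prop) : Prop :=
  zariski_closed (fun H => ~ U H).

Definition generic (R : realType) (K : nat) (M N : 'I_K -> nat)
    (P : channels R M N -> Prop) : Prop :=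
  exists U : channels R M N -> Prop,
    [/\ zariski_open U, (exists H, U H) & forall H, U H -> P H].

(* "A ^t*" is the conjugate transpose of A. *)
Definition ia_achievable (R : realType) (K : nat) (M N : 'I_K -> nat)
    (H : channels R M N) (d : 'I_K -> nat) : Prop :=
  exists (V : forall k : 'I_K, 'M[R[i]]_(M k, d k))
         (U : forall k : 'I_K, 'M[R[i]]_(N k, d k)),
    (forall k j : 'I_K, j != k -> (U k) ^t* *m H k j *m V j = 0) /\
    (forall k : 'I_K, \rank ((U k) ^t* *m H k k *m V k) = d k).

(* Main.v *)
(* For the third inequality, count parameters. If d is achievable, the precoders
   V k and the conjugate transposed filters W j = (U j)^t* have full rank, so a
   change of basis makes a d k by d k submatrix of each the identity; there are
   finitely many positions for these identity blocks. Each alignment equation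
   indexed by I, (k, j) and a pair of streams then expresses one entry of H j k
   polynomially in the remaining entries of V, W and H. If the inequality fails
   for I, the channels are therefore polynomial functions of fewer parameters
   than they have entries, and such functions satisfy a nontrivial polynomial
   relation. For the second inequality, W j *m H j k *m V k = 0 and Frobenius'
   rank inequality give d k + d j + \rank (H j k) <= M k + N j, and generically
   H j k has full rank. Only finitely many d and I matter, so the product of the
   finitely many polynomials obtained defines the open set. *)
Require Import Defs.
From mathcomp Require Import all_boot all_order all_algebra.
From mathcomp Require Import reals.
From mathcomp Require Import spectral complex mpoly zify.

Import Order.TTheory GRing.Theory Num.Theory.
Local Open Scope ring_scope.

Set Implicit Arguments.
Unset Strict Implicit.
Unset Printing Implicit Defensive.

(** * Polynomials: points of nonvanishing and algebraic dependence *)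

(** Reduction modulo [B] recovers the lowest digit, and cancelling a factor [B] leaves the others.
    This keeps the exponents of the Kronecker substitution distinct. *)
Lemma digits_inj (n B : nat) (e e' : 'I_n -> nat) :
  (forall i, e i < B)%N -> (forall i, e' i < B)%N ->
  (\sum_i e i * B ^ i = \sum_i e' i * B ^ i)%N -> e =1 e'.
Proof.
elim: n e e' => [|n IHn] e e' he he'; first by move=> _ [].
have step (g : 'I_n.+1 -> nat) :
    (\sum_i g i * B ^ i = (\sum_i g (lift ord0 i) * B ^ i) * B + g ord0)%N.
  rewrite big_ord_recl expn0 muln1 addnC big_distrl /=; congr (_ + _)%N.
  by apply: eq_bigr => i _; rewrite -mulnA -expnSr.
rewrite !step => eqs.
have B_gt0 : (0 < B)%N by apply: leq_ltn_trans (he ord0).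
have eq0 : e ord0 = e' ord0.
  have := congr1 (modn^~ B) eqs.
  by rewrite /= !modnMDl !modn_small.
have eqr : (\sum_i e (lift ord0 i) * B ^ i = \sum_i e' (lift ord0 i) * B ^ i)%N.
  have /eqP := eqs; rewrite eq0 eqn_add2r eqn_pmul2r //.
  by move/eqP.
have eql := IHn _ _ (fun i => he _) (fun i => he' _) eqr.
by move=> i; have [j ->|->] := unliftP ord0 i; [apply: eql | apply: eq0].
Qed.

Lemma mnm_lt_msize (F : nzRingType) (n : nat) (p : {mpoly F[n]}) m i :
  m \in msupp p -> (m i < msize p)%N.
Proof.
move=> /msize_mdeg_lt; apply: leq_ltn_trans.
by rewrite mdegE (bigD1 i) //= leq_addr.
Qed.

(* Kronecker substitution: at the point (x ^ B^i)_i with B > deg p, distinct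
   monomials of p become distinct powers of x. *)
Lemma mpoly_nonroot (F : numFieldType) (n : nat) (p : {mpoly F[n]}) :
  p != 0 -> exists x : 'I_n -> F, p.@[x] != 0.
Proof.
move=> p0; set B := msize p.
pose w (m : 'X_{1..n}) := (\sum_i m i * B ^ i)%N.
pose q : {poly F} := \sum_(m <- msupp p) p@_m *: 'X^(w m).
have q0 : q != 0.
  apply/eqP => q0.
  have mp : mlead p \in msupp p by apply: mlead_supp.
  have := congr1 (fun q : {poly F} => q`_(w (mlead p))) q0.
  rewrite coef_sum coef0 (bigD1_seq (mlead p)) ?msupp_uniq //= big1_seq.
    rewrite coefZ coefXn eqxx mulr1 addr0 => /eqP.
    by rewrite mcoeff_eq0 mp.
  move=> m' /andP[m'm m'p]; rewrite coefZ coefXn.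
  case: eqP => [eqw|]; last by rewrite mulr0.
  case/eqP: m'm; apply/mnmP => i; symmetry; move: i; apply: digits_inj eqw => i.
    exact: mnm_lt_msize.
  exact: mnm_lt_msize.
have [x hx] : exists x, q.[x] != 0.
  (* A nonzero [q] has fewer than [size q] roots, and naturals stay distinct in characteristic
     zero. *)
  pose rs : seq F := [seq i%:R | i <- iota 0 (size q)].
  have rsu : uniq rs.
    by rewrite map_inj_uniq ?iota_uniq // => i j /eqP; rewrite eqr_nat => /eqP.
  have [allr|/allPn[x _ hx]] := boolP (all (root q) rs); last by exists x.
  by have := max_poly_roots q0 allr rsu; rewrite size_map size_iota ltnn.
exists (fun i => x ^+ (B ^ i)); apply: contraNneq hx => px.
rewrite -{}px mevalE /q horner_sum; apply/eqP; apply: eq_bigr => m _.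
rewrite hornerZ hornerXn /w expr_sum; congr (_ * _); apply: eq_bigr => i _.
by rewrite -exprM mulnC.
Qed.

(** [msize] is the total degree plus one, and 0 for the zero polynomial; with bounds of the form
    [c.+1] the degree bounds simply add. *)
Lemma leq_msizeM (F : idomainType) (n : nat) (p q : {mpoly F[n]}) (c c' : nat) :
  (msize p <= c.+1)%N -> (msize q <= c'.+1)%N -> (msize (p * q) <= (c + c').+1)%N.
Proof.
move=> pc qc; have [->|p0] := eqVneq p 0; first by rewrite mul0r msize0.
have [->|q0] := eqVneq q 0; first by rewrite mulr0 msize0.
rewrite msizeM //; move: pc qc; rewrite -![msize _]/(mmeasure _ _); lia.
Qed.

Lemma leq_msizeX (F : idomainType) (n : nat) (p : {mpoly F[n]}) (k c : nat) :
  (msize p <= c.+1)%N -> (msize (p ^+ k) <= (k * c).+1)%N.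
Proof.
move=> pc; elim: k => [|k IHk]; first by rewrite expr0 msize1.
by rewrite exprS mulSn leq_msizeM.
Qed.

Lemma leq_msize_prod (F : idomainType) (n : nat) (I : finType)
    (p : I -> {mpoly F[n]}) (c : nat) :
  (forall i, msize (p i) <= c.+1)%N -> (msize (\prod_i p i) <= (#|I| * c).+1)%N.
Proof.
move=> pc; rewrite cardE -big_enum /=.
elim: (enum I) => [|i s IHs]; first by rewrite big_nil msize1.
by rewrite big_cons mulSn leq_msizeM.
Qed.

(* Counting: the t^b monomials in the p i with exponents < t all lie in a
   space spanned by (b t c + 1)^a monomials, so they are linearly dependent
   once t > (b c + 1)^a. *)
Lemma mpoly_dependent (F : fieldType) (a b : nat) (p : 'I_b -> {mpoly F[a]}) :
  (a < b)%N ->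
  exists2 P : {mpoly F[b]}, P != 0 &
    forall x : 'I_a -> F, P.@[fun i => (p i).@[x]] = 0.
Proof.
move=> ab; pose c := (\max_i msize (p i))%N.
have pc i : (msize (p i) <= c.+1)%N by apply: leqW; apply: leq_bigmax.
pose t := ((b * c).+1 ^ a).+1; pose B := (b * (t * c)).+1.
pose E := {ffun 'I_b -> 'I_t}; pose G := {ffun 'I_a -> 'I_B}.
pose f (e : E) := \prod_i p i ^+ e i.
have f_small e : (msize (f e) <= B)%N.
  rewrite /B -[X in (X * _)%N]card_ord; apply: leq_msize_prod => i.
  apply: leq_trans (leq_msizeX _ (pc i)) _.
  by rewrite ltnS leq_mul2r ltnW ?orbT.
(* Here [B <= (b * c).+1 * t] and [(b * c).+1 ^ a < t], so [B ^ a < t ^ a.+1 <= t ^ b]. *)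
have BtE : (B ^ a < t ^ b)%N.
  apply: (@leq_ltn_trans (((b * c).+1 * t) ^ a)).
    have Bt : (B <= (b * c).+1 * t)%N by rewrite /B; nia.
    by case: (a) => // a'; rewrite leq_exp2r.
  rewrite expnMn; apply: (@leq_trans (t ^ a.+1)); last by rewrite leq_pexp2l.
  by rewrite expnS ltn_pmul2r ?expn_gt0 // ltnSn.
(* Each row holds the coefficients of one product [f e]; there are more rows than columns, so the
   left kernel is nonzero. *)
pose A : 'M[F]_(#|{: E}|, #|{: G}|) :=
  \matrix_(i, j) (f (enum_val i))@_[multinom ((enum_val j : G) k : nat) | k < a].
have : kermx A != 0.
  rewrite kermx_eq0; apply/negP => /eqP rA; have := rank_leq_col A.
  by rewrite rA !card_ffun !card_ord leqNgt BtE.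
case/rowV0Pn => u /sub_kermxP uA u0.
pose mn (e : E) : 'X_{1..b} := [multinom (e i : nat) | i < b].
have mn_inj : injective mn.
  move=> e e' /mnmP ee; apply/ffunP => i; apply: val_inj.
  by have := ee i; rewrite !mnmE.
pose U (e : E) := u 0 (enum_rank e).
exists (\sum_(e : E) U e *: 'X_[mn e]).
  apply: contraNneq u0 => P0; apply/eqP/rowP => i.
  have := congr1 (mcoeff (mn (enum_val i))) P0.
  rewrite mcoeff0 raddf_sum (bigD1 (enum_val i)) //= big1 => [|e ei].
    by rewrite mcoeffZ mcoeffX eqxx mulr1 addr0 /U enum_valK mxE.
  by rewrite mcoeffZ mcoeffX (inj_eq mn_inj) (negPf ei) mulr0.
move=> x.
have -> : (\sum_e U e *: 'X_[mn e]).@[fun i => (p i).@[x]] =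
          (\sum_e U e *: f e).@[x].
  rewrite !raddf_sum; apply: eq_bigr => e _ /=; rewrite !mevalZ mevalX.
  rewrite /f rmorph_prod; congr (_ * _); apply: eq_bigr => i _.
  by rewrite rmorphXn /= mnmE.
suff -> : \sum_e U e *: f e = 0 by rewrite meval0.
apply/mpolyP => m; rewrite mcoeff0 raddf_sum /=.
have [mB|] := boolP [forall k, m k < B]%N.
  pose g : G := [ffun k => inord (m k)].
  have mg : m = [multinom (g k : nat) | k < a].
    by apply/mnmP => k; rewrite mnmE ffunE inordK // (forallP mB).
  have := congr1 (fun v : 'rV_ _ => v 0 (enum_rank g)) uA; rewrite !mxE => {2}<-.
  rewrite (reindex (@enum_val E xpredT)) /=; last exact: (onW_bij _ (@enum_val_bij E)).
  apply: eq_bigr => i _; rewrite mcoeffZ /U enum_valK mxE enum_rankK.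
  by rewrite -mg.
(* An exponent of at least [B] exceeds the degree of every [f e], so the columns of [A] miss no
   coefficient. *)
case/forallPn => k; rewrite -leqNgt => mk; apply: big1 => e _.
rewrite mcoeffZ [_@__]memN_msupp_eq0 ?mulr0 //.
apply/negP => /(@mnm_lt_msize _ _ _ _ k).
by rewrite ltnNge (leq_trans (f_small e) mk).
Qed.

(** * Functions polynomial in finitely many parameters *)

(** [T] is any type of points, such as the solutions of some equations, and [y] gives their
    coordinates. One [p] serves all points, and identities that hold only on [T] may be used to find
    it. *)
Definition poly_in (F : comNzRingType) (X : finType) (T : Type) (y : T -> X -> F)
    (f : T -> F) : Prop :=
  exists p : {mpoly F[#|X|]}, forall t, f t = p.@[fun i => y t (enum_val i)].

Section PolyIn.
Variables (F : comNzRingType) (X : finType) (T : Type) (y : T -> X -> F).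

Lemma poly_in_ext f g : f =1 g -> poly_in y f -> poly_in y g.
Proof. by move=> fg [p hp]; exists p => t; rewrite -fg. Qed.

Lemma poly_in_cst c : poly_in y (fun=> c).
Proof. by exists c%:MP => t; rewrite mevalC. Qed.

Lemma poly_in_var x : poly_in y (y^~ x).
Proof. by exists 'X_(enum_rank x) => t; rewrite mevalXU enum_rankK. Qed.

Lemma poly_inN f : poly_in y f -> poly_in y (fun t => - f t).
Proof. by case=> p hp; exists (- p) => t; rewrite mevalN hp. Qed.

Lemma poly_inM f g : poly_in y f -> poly_in y g -> poly_in y (fun t => f t * g t).
Proof. by case=> p hp [q hq]; exists (p * q) => t; rewrite mevalM hp hq. Qed.

Lemma poly_in_sum (J : finType) (P : pred J) (f : J -> T -> F) :
  (forall j, P j -> poly_in y (f j)) -> poly_in y (fun t => \sum_(j | P j) f j t).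
Proof.
(* The witnesses are chosen for all [j] at once, so an index outside [P] gets the default 0. *)
move=> h; have {}h j : exists p : {mpoly F[#|X|]}, P j ->
    forall t, f j t = p.@[fun i => y t (enum_val i)].
  by case Pj: (P j); [have [p] := h j Pj; exists p | exists 0].
have [p hp] := fin_all_exists h; exists (\sum_(j | P j) p j) => t.
by rewrite raddf_sum; apply: eq_bigr => j Pj; apply: hp.
Qed.

Lemma poly_in_prod (J : finType) (f : J -> T -> F) :
  (forall j, poly_in y (f j)) -> poly_in y (fun t => \prod_j f j t).
Proof.
move=> h; have [p hp] := fin_all_exists h; exists (\prod_j p j) => t.
by rewrite rmorph_prod; apply: eq_bigr => j _; apply: hp.
Qed.

Lemma poly_in_det n (A : T -> 'M[F]_n) :
  (forall i j, poly_in y (fun t => A t i j)) -> poly_in y (fun t => \det (A t)).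
Proof.
move=> h; apply: poly_in_sum => s _; apply: poly_inM; first exact: poly_in_cst.
exact: poly_in_prod.
Qed.

End PolyIn.

Lemma poly_in_dependent (F : fieldType) (X Y : finType) (T : Type)
    (y : T -> X -> F) (z : T -> Y -> F) :
  (#|X| < #|Y|)%N -> (forall e, poly_in y (z^~ e)) ->
  exists2 P : {mpoly F[#|Y|]}, P != 0 & forall t, P.@[fun i => z t (enum_val i)] = 0.
Proof.
move=> XY /fin_all_exists[p hp].
have [P P0 hP] := mpoly_dependent (fun i => p (enum_val i)) XY.
exists P => // t; rewrite -(hP (fun i => y t (enum_val i))).
by apply: meval_eq => i; apply: hp.
Qed.

(** * Thin sets of channels and genericity *)

Section Channels.
Variables (R : realType) (K : nat) (M N : 'I_K -> nat).

Definition chan_entry (H : channels R M N) (e : entry M N) : R[i] :=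
  H (tag e).1 (tag e).2 (tagged e).1 (tagged e).2.

Definition mk_entry (k j : 'I_K) (a : 'I_(N k)) (b : 'I_(M j)) : entry M N :=
  @Tagged _ (k, j) (fun kj => 'I_(N kj.1) * 'I_(M kj.2))%type (a, b).

(** These are the exceptional sets: finite unions of them stay thin, by multiplying the polynomials,
    and the complement of one contains a nonempty Zariski open set. *)
Definition thin (Z : channels R M N -> Prop) : Prop :=
  exists2 P : {mpoly R[i][#|entry M N|]}, P != 0 &
    forall H, Z H -> P.@[coords H] = 0.

Lemma sub_thin (Z Z' : channels R M N -> Prop) :
  (forall H, Z H -> Z' H) -> thin Z' -> thin Z.
Proof. by move=> ZZ' [P P0 hP]; exists P => // H /ZZ'/hP. Qed.

Lemma thin0 : thin (fun=> False).
Proof. by exists 1; rewrite ?oner_eq0. Qed.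

(** Used to discard the members of a finite union whose index fails a decidable condition. *)
Lemma thin_and (b : bool) (Z : channels R M N -> Prop) :
  (b -> thin Z) -> thin (fun H => b /\ Z H).
Proof.
case: b => [/(_ isT)|_]; first by apply: sub_thin => H [].
by apply: sub_thin thin0 => H [].
Qed.

Lemma thin_exists (J : finType) (Z : J -> channels R M N -> Prop) :
  (forall j, thin (Z j)) -> thin (fun H => exists j, Z j H).
Proof.
move=> h; have {}h j : exists P : {mpoly R[i][#|entry M N|]},
    P != 0 /\ forall H, Z j H -> P.@[coords H] = 0.
  by have [P] := h j; exists P.
have [P hP] := fin_all_exists h; exists (\prod_j P j).
  by apply/prodf_neq0 => j _; case: (hP j).
move=> H [j Zj]; rewrite rmorph_prod (bigD1 j) //=.
by rewrite (proj2 (hP j)) // mul0r.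
Qed.

Lemma thin_or (Z Z' : channels R M N -> Prop) :
  thin Z -> thin Z' -> thin (fun H => Z H \/ Z' H).
Proof.
case=> P P0 hP [Q Q0 hQ]; exists (P * Q); first by rewrite mulf_neq0.
by move=> H [/hP|/hQ]; rewrite mevalM => ->; rewrite ?mul0r ?mulr0.
Qed.

Definition chan_of (x : 'I_#|entry M N| -> R[i]) : channels R M N :=
  fun k j => \matrix_(a, b) x (enum_rank (mk_entry a b)).

Lemma coords_chan_of x : coords (chan_of x) =1 x.
Proof.
move=> i; rewrite /coords /chan_of mxE.
congr x; rewrite -[RHS]enum_valK; congr enum_rank.
by case: (enum_val i) => [[k j] [a b]].
Qed.

Lemma thin_generic (Z P : channels R M N -> Prop) :
  thin Z -> (forall H, ~ Z H -> P H) -> generic P.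
Proof.
case=> p p0 hp ZP; exists (fun H => p.@[coords H] != 0); split.
- exists (eq p) => H; split=> [/negP/negPn/eqP pH q <- // | /(_ _ erefl) ->].
  by rewrite eqxx.
- have [x hx] := mpoly_nonroot p0; exists (chan_of x).
  by rewrite (meval_eq _ (coords_chan_of x)).
- by move=> H pH; apply: ZP => /hp/eqP; apply/negP.
Qed.

(** The leading maximal minor of [H k j] vanishes where the rank drops, and it is a nonzero
    polynomial because it equals 1 at the channels [pid_mx]. *)
Lemma thin_rank_lt (k j : 'I_K) :
  thin (fun H => (\rank (H k j) < minn (N k) (M j))%N).
Proof.
pose s (H : channels R M N) : 'M[R[i]]_(minn (N k) (M j)) :=
  mxsub (widen_ord (geq_minl _ _)) (widen_ord (geq_minr _ _)) (H k j).
have [p hp] : poly_in chan_entry (fun H => \det (s H)).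
  apply: poly_in_det => a b.
  apply: poly_in_ext (poly_in_var chan_entry _) => H; rewrite mxE.
  exact: (erefl (chan_entry H (mk_entry _ _))).
exists p.
  apply/eqP => p0; have := hp (fun k j => pid_mx (minn (N k) (M j))).
  rewrite p0 meval0 (_ : s _ = 1%:M) ?det1; first by move/eqP; rewrite oner_eq0.
  by apply/matrixP => a b; rewrite !mxE /= ltn_ord andbT.
move=> H; rewrite -[p.@[_]]hp => rH; apply/eqP; apply: contraLR rH => s0.
have us : s H \in unitmx by rewrite unitmxE unitfE.
rewrite -leqNgt -{1}(mxrank_unit us) /s -[H k j]mulmx1 mxsub_mul rowsubE mulmx1.
exact: leq_trans (mxrankM_maxl _ _) (mxrankM_maxr _ _).
Qed.

End Channels.

(** * Parameter count for normalized alignment solutions *)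

Lemma card_set_tagged (J : finType) (S : J -> finType) (P : pred {j : J & S j}) :
  #|[set e | P e]| = (\sum_j #|[set s : S j | P (Tagged S s)]|)%N.
Proof.
under [RHS]eq_bigr do rewrite -sum1dep_card.
by rewrite sig_big_dep -sum1dep_card; apply: eq_bigl => -[].
Qed.

Section Parametrization.
Variables (R : realType) (K : nat) (M N d : 'I_K -> nat) (I : {set 'I_K * 'I_K}).
Variables (f : forall k, {ffun 'I_(d k) -> 'I_(M k)}).
Variables (g : forall k, {ffun 'I_(d k) -> 'I_(N k)}).
Variables (T : Type) (H : T -> channels R M N).
Variables (V : T -> forall k, 'M[R[i]]_(M k, d k)).
Variables (W : T -> forall k, 'M[R[i]]_(d k, N k)).
Hypothesis f_inj : forall k, injective (f k).
Hypothesis g_inj : forall k, injective (g k).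
Hypothesis fV : forall t k, rowsub (f k) (V t k) = 1%:M.
Hypothesis gW : forall t k, colsub (g k) (W t k) = 1%:M.
Hypothesis WHV : forall t k j, (k, j) \in I -> W t j *m H t j k *m V t k = 0.

Let inA k := [exists j, (k, j) \in I].
Let inB j := [exists k, (k, j) \in I].

Let EV := {k : 'I_K & ('I_(M k) * 'I_(d k))%type}.
Let EW := {k : 'I_K & ('I_(d k) * 'I_(N k))%type}.

Let freeV : {set EV} :=
  [set e | inA (tag e) && ((tagged e).1 \notin codom (f (tag e)))].
Let freeW : {set EW} :=
  [set e | inB (tag e) && ((tagged e).2 \notin codom (g (tag e)))].
(** The entries for which the alignment equations indexed by [I] are solved. An index in [entry M N]
    puts the receiver first, a pair in [I] the transmitter, hence the swap. *)
Let pivotH : {set entry M N} :=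
  [set e | [&& ((tag e).2, (tag e).1) \in I,
               (tagged e).1 \in codom (g (tag e).1) &
               (tagged e).2 \in codom (f (tag e).2)]].

Let X : finType := ({e | e \in freeV} + {e | e \in freeW} + {e | e \in ~: pivotH})%type.

Let y (t : T) (x : X) : R[i] :=
  match x with
  | inl (inl e) => V t (tag (val e)) (tagged (val e)).1 (tagged (val e)).2
  | inl (inr e) => W t (tag (val e)) (tagged (val e)).1 (tagged (val e)).2
  | inr e => chan_entry (H t) (val e)
  end.

(** A row of [V t k] in the range of [f k] is a row of the identity, hence constant; any other entry
    is itself a parameter. *)
Let poly_V k r c : inA k -> poly_in y (fun t => V t k r c).
Proof.
move=> Ak; have [/codomP[a ->]|hr] := boolP (r \in codom (f k)).
  apply: poly_in_ext (poly_in_cst y (a == c)%:R) => t.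
  by have /matrixP/(_ a c) := fV t k; rewrite !mxE.
pose e : EV := @Tagged _ k (fun k => 'I_(M k) * 'I_(d k))%type (r, c).
have he : e \in freeV by rewrite inE /= Ak.
exact: (poly_in_var y (inl (inl (exist _ e he)))).
Qed.

Let poly_W k c r : inB k -> poly_in y (fun t => W t k c r).
Proof.
move=> Bk; have [/codomP[a ->]|hr] := boolP (r \in codom (g k)).
  apply: poly_in_ext (poly_in_cst y (c == a)%:R) => t.
  by have /matrixP/(_ c a) := gW t k; rewrite !mxE.
pose e : EW := @Tagged _ k (fun k => 'I_(d k) * 'I_(N k))%type (c, r).
have he : e \in freeW by rewrite inE /= Bk.
exact: (poly_in_var y (inl (inr (exist _ e he)))).
Qed.

Let poly_H_free e : e \notin pivotH -> poly_in y (fun t => chan_entry (H t) e).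
Proof.
rewrite -in_setC => he; exact: (poly_in_var y (inr (exist _ e he))).
Qed.

(* On the pivot rows and columns W and V are identity matrices, so among the
   pivot entries of H j k only (g j a, f k b) contributes to this equation. *)
Let WHV_entry t k j a b : (k, j) \in I ->
  H t j k (g j a) (f k b) =
  - \sum_(rs : 'I_(N j) * 'I_(M k) |
          mk_entry (M := M) rs.1 rs.2 \notin pivotH)
      W t j a rs.1 * H t j k rs.1 rs.2 * V t k rs.2 b.
Proof.
move=> kjI; apply/eqP; rewrite -subr_eq0 opprK.
have Wg c a' : W t j c (g j a') = (c == a')%:R.
  by have /matrixP/(_ c a') := gW t j; rewrite !mxE.
have Vf b' c : V t k (f k b') c = (b' == c)%:R.
  by have /matrixP/(_ b' c) := fV t k; rewrite !mxE.
have /matrixP/(_ a b) := WHV t kjI; rewrite mxE [RHS]mxE => WHV0.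
apply/eqP; rewrite -[RHS]WHV0 {WHV0}.
under [RHS]eq_bigr do rewrite mxE big_distrl /=.
rewrite exchange_big pair_bigA /=.
rewrite [RHS](bigID (fun rs => mk_entry (M := M) rs.1 rs.2 \in pivotH)) /=.
congr (_ + _); rewrite (bigD1 (g j a, f k b)) /=; last first.
  by rewrite inE /= kjI !codom_f.
rewrite Wg Vf !eqxx mul1r mulr1 big1 ?addr0 // => -[r s] /=.
rewrite inE /= kjI /= => /andP[/andP[/codomP[a' ->] /codomP[b' ->]]].
rewrite xpair_eqE (inj_eq (@g_inj _)) (inj_eq (@f_inj _)) Wg Vf (eq_sym a).
by case: eqP => _; case: eqP => _; rewrite ?mulr0 ?mul0r.
Qed.

(** The right side of [WHV_entry] contains no pivot entry of the channels, so eliminating the pivot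
    entries is not circular. *)
Let poly_H e : poly_in y (fun t => chan_entry (H t) e).
Proof.
have [|/poly_H_free //] := boolP (e \in pivotH).
case: e => -[j k] [r s]; rewrite inE /= => /and3P[kjI /codomP[a ->] /codomP[b ->]].
apply: poly_in_ext (fun t => esym (WHV_entry t a b kjI)) _.
apply: poly_inN; apply: poly_in_sum => -[r' s'] /= he.
apply: poly_inM; last by apply: poly_V; apply/existsP; exists j.
apply: poly_inM; first by apply: poly_W; apply/existsP; exists k.
exact: poly_H_free he.
Qed.

Let card_freeV : #|freeV| = (\sum_(k | inA k) (M k - d k) * d k)%N.
Proof.
rewrite card_set_tagged /= [RHS]big_mkcond; apply: eq_bigr => k _.
case: (inA k); last by apply: eq_card0 => x; rewrite inE.
rewrite (_ : [set _ | _] = setX (~: [set r in codom (f k)]) setT).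
  by rewrite cardsX cardsT card_ord cardsCs setCK cardsE (card_codom (@f_inj k)) !card_ord.
by apply/setP => -[r c]; rewrite !inE andbT.
Qed.

Let card_freeW : #|freeW| = (\sum_(k | inB k) (N k - d k) * d k)%N.
Proof.
rewrite card_set_tagged /= [RHS]big_mkcond; apply: eq_bigr => k _.
case: (inB k); last by apply: eq_card0 => x; rewrite inE.
rewrite (_ : [set _ | _] = setX setT (~: [set r in codom (g k)])).
  rewrite cardsX cardsT card_ord cardsCs setCK cardsE (card_codom (@g_inj k)) !card_ord.
  by rewrite mulnC.
by apply/setP => -[r c]; rewrite !inE.
Qed.

Let card_pivotH : #|pivotH| = (\sum_(kj in I) d kj.1 * d kj.2)%N.
Proof.
rewrite card_set_tagged /= [RHS]big_mkcond /=.
rewrite (reindex (fun kj : 'I_K * 'I_K => (kj.2, kj.1))) /=; last first.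
  by exists (fun kj : 'I_K * 'I_K => (kj.2, kj.1)) => -[].
apply: eq_bigr => -[k j] _ /=.
case: ifP => _; last by apply: eq_card0 => x; rewrite inE.
rewrite (_ : [set _ | _] = setX [set r in codom (g j)] [set s in codom (f k)]).
  by rewrite cardsX !cardsE (card_codom (@g_inj j)) (card_codom (@f_inj k)) !card_ord mulnC.
by apply/setP => -[r c]; rewrite !inE.
Qed.

(** The non-pivot entries count both as parameters and as coordinates. After cancelling them, the
    hypothesis says that there are fewer parameters than coordinates. *)
Lemma thin_parametrized :
  (\sum_(k | [exists j, (k, j) \in I]) (M k - d k) * d k +
   \sum_(j | [exists k, (k, j) \in I]) (N j - d j) * d j <
   \sum_(kj in I) d kj.1 * d kj.2)%N ->
  thin (fun H0 => exists t, H t = H0).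
Proof.
rewrite -card_freeV -card_freeW -card_pivotH => lt.
have XY : (#|X| < #|entry M N|)%N.
  rewrite !card_sum !card_sig -(cardsC pivotH) ltn_add2r.
  by rewrite (eq_card (B := freeV)) // (eq_card (B := freeW)).
have [P P0 hP] := poly_in_dependent XY poly_H.
by exists P => // H0 [t <-]; apply: hP.
Qed.

End Parametrization.

(** * Normalizing the precoders and filters *)

(** Select [n] independent rows of [A] and take for [B] the inverse of the submatrix they form. *)
Lemma row_full_normalize (F : fieldType) (m n : nat) (A : 'M[F]_(m, n)) :
  row_full A -> exists f : {ffun 'I_n -> 'I_m},
    injective f /\ exists B : 'M_n, rowsub f (A *m B) = 1%:M.
Proof.
move=> fA; exists (fullrankfun fA); split; first exact: fullrankfun_inj.
exists (invmx (rowsub (fullrankfun fA) A)); rewrite -mul_rowsub_mx mulmxV //.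
exact: fullrowsub_unit.
Qed.

(** Taking [W k] to be the conjugate transpose of [U k] removes conjugation, which is not
    polynomial. The rank of the product bounds the ranks of both outer factors from below. *)
Lemma ia_achievable_full (R : realType) (K : nat) (M N : 'I_K -> nat)
    (H : channels R M N) (d : 'I_K -> nat) :
  ia_achievable H d ->
  exists (V : forall k, 'M[R[i]]_(M k, d k)) (W : forall k, 'M[R[i]]_(d k, N k)),
    [/\ forall k, \rank (V k) = d k, forall k, \rank (W k) = d k &
        forall k j, j != k -> W k *m H k j *m V j = 0].
Proof.
case=> V [U [UHV rk]].
exists V, (fun k => ((U k) ^t* : 'M_(d k, N k))%sesqui); split=> // k; apply/eqP.
  by rewrite eqn_leq rank_leq_col -{1}(rk k) mxrankM_maxr.
rewrite eqn_leq rank_leq_row -{1}(rk k) -mulmxA; exact: mxrankM_maxl.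
Qed.

Lemma thin_ia_achievable (R : realType) (K : nat) (M N d : 'I_K -> nat)
    (I : {set 'I_K * 'I_K}) :
  I \subset [set kj | kj.1 != kj.2] ->
  (\sum_(k | [exists j, (k, j) \in I]) (M k - d k) * d k +
   \sum_(j | [exists k, (k, j) \in I]) (N j - d j) * d j <
   \sum_(kj in I) d kj.1 * d kj.2)%N ->
  thin (fun H : channels R M N => ia_achievable H d).
Proof.
move=> /subsetP sI lt.
pose piv (m : 'I_K -> nat) := {dffun forall k, {ffun 'I_(d k) -> 'I_(m k)}}.
(* The solutions normalized at positions [f] and [g], packed with their equations so that the
   hypotheses of the parametrization hold at every point. Finitely many pairs [f], [g] cover all
   achievable cases. *)
pose T (f : piv M) (g : piv N) :=
  {t : channels R M N * (forall k, 'M[R[i]]_(M k, d k)) *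
       (forall k, 'M[R[i]]_(d k, N k)) |
     [/\ forall k, rowsub (f k) (t.1.2 k) = 1%:M,
         forall k, colsub (g k) (t.2 k) = 1%:M &
         forall k j, (k, j) \in I -> t.2 j *m t.1.1 j k *m t.1.2 k = 0]}.
pose Z (H : channels R M N) := (exists (f : piv M) (g : piv N),
  ([forall k, injectiveb (f k)] && [forall k, injectiveb (g k)]) /\
  exists t : T f g, (sval t).1.1 = H).
suff sZ : forall H : channels R M N, ia_achievable H d -> Z H.
  apply: (sub_thin sZ).
  apply: thin_exists => f; apply: thin_exists => g; apply: thin_and.
  case/andP=> /forallP f_inj /forallP g_inj.
  apply: (@thin_parametrized _ _ _ _ d I f g (T f g) (fun t => (sval t).1.1)
    (fun t => (sval t).1.2) (fun t => (sval t).2)) lt.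
  - by move=> k; apply/injectiveP.
  - by move=> k; apply/injectiveP.
  - by case=> t [].
  - by case=> t [].
  - by case=> t [].
move=> H /ia_achievable_full[V [W [rV rW WHV]]].
have /fin_all_exists[f hf] k : exists f : {ffun 'I_(d k) -> 'I_(M k)},
    injective f /\ exists B, rowsub f (V k *m B) = 1%:M.
  by apply: row_full_normalize; rewrite /row_full rV.
have /fin_all_exists[g hg] k : exists g : {ffun 'I_(d k) -> 'I_(N k)},
    injective g /\ exists B, colsub g (B *m W k) = 1%:M.
  (* The filters are normalized on columns by a change of basis on the left; transposing reduces
     this to rows. *)
  have [|g [g_inj [B hB]]] := @row_full_normalize _ _ _ (W k)^T.
    by rewrite /row_full mxrank_tr rW.
  exists g; split=> //; exists B^T.
  by apply: trmx_inj; rewrite trmx_mxsub trmx_mul trmxK trmx1.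
have /fin_all_exists[B hB] k := proj2 (hf k).
have /fin_all_exists[C hC] k := proj2 (hg k).
exists (finfun f), (finfun g); split.
  by apply/andP; split; apply/forallP => k; apply/injectiveP; rewrite ffunE;
    case: (hf k); case: (hg k).
pose t := ((H, fun k => V k *m B k), fun k => C k *m W k).
suff ht : [/\ forall k, rowsub (finfun f k) (t.1.2 k) = 1%:M,
         forall k, colsub (finfun g k) (t.2 k) = 1%:M &
         forall k j, (k, j) \in I -> t.2 j *m t.1.1 j k *m t.1.2 k = 0].
  by exists (exist _ t ht).
split=> [k|k|k j /sI]; rewrite ?ffunE //= inE => kj.
by rewrite !mulmxA -[C j *m _ *m _]mulmxA -[C j *m _ *m _]mulmxA WHV // mulmx0 mul0mx.
Qed.

(** * The three inequalities *)

Theorem theorem1 (R : realType) (K : nat) (hK : (1 <= K)%N)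
    (M N : 'I_K -> nat)
    (hM : forall k, (0 < M k)%N) (hN : forall k, (0 < N k)%N) :
  generic (fun H : channels R M N =>
    forall d : 'I_K -> nat, ia_achievable H d ->
      [/\ forall k : 'I_K, (d k <= minn (M k) (N k))%N,
          forall k j : 'I_K, k != j -> (d k + d j <= maxn (M k) (N j))%N
        & forall I : {set 'I_K * 'I_K},
            I \subset [set kj : 'I_K * 'I_K | kj.1 != kj.2] ->
            \sum_(kj in I) (d kj.1)%:Z * (d kj.2)%:Z
            <= \sum_(k : 'I_K | [exists j : 'I_K, (k, j) \in I])
                 ((M k)%:Z - (d k)%:Z) * (d k)%:Z
             + \sum_(j : 'I_K | [exists k : 'I_K, (k, j) \in I])
                 ((N j)%:Z - (d j)%:Z) * (d j)%:Z]).
Proof.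
pose viol (d : 'I_K -> nat) (I : {set 'I_K * 'I_K}) :=
  (I \subset [set kj | kj.1 != kj.2]) &&
  (\sum_(k | [exists j, (k, j) \in I]) (M k - d k) * d k +
   \sum_(j | [exists k, (k, j) \in I]) (N j - d j) * d j <
   \sum_(kj in I) d kj.1 * d kj.2)%N.
(* Achievable [d] satisfy [d k <= M k], so the sum of all [M k] is a uniform bound that places them
   in a finite type. *)
pose nat_of (d : {ffun 'I_K -> 'I_(\sum_k M k).+1}) k : nat := d k.
apply: (@thin_generic _ _ _ _ (fun H =>
  (exists k, exists j, \rank (H k j) < minn (N k) (M j))%N \/
  exists d, exists I, viol (nat_of d) I /\ ia_achievable H (nat_of d))).
  apply: thin_or.
    by apply: thin_exists => k; apply: thin_exists => j; apply: thin_rank_lt.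
  apply: thin_exists => d; apply: thin_exists => I.
  by apply: thin_and => /andP[]; apply: thin_ia_achievable.
move=> H good d ach.
have [V [W [rV rW WHV]]] := ia_achievable_full ach.
have dM k : (d k <= M k)%N by rewrite -(rV k) rank_leq_row.
have dN k : (d k <= N k)%N by rewrite -(rW k) rank_leq_col.
split=> [k|k j kj|I sI]; first by rewrite leq_min dM dN.
  have rH : (minn (N j) (M k) <= \rank (H j k))%N.
    by rewrite leqNgt; apply/negP => lt; apply: good; left; exists j, k.
  (* Sylvester's inequality bounds the ranks of [W j *m H j k] and [H j k *m V k] from below; the
     maximum arises as the sum of [M k] and [N j] minus their minimum. *)
  have := mxrank_Frobenius (W j) (H j k) (V k); rewrite WHV // mxrank0 addn0.
  have := mxrank_mul_min (W j) (H j k); have := mxrank_mul_min (H j k) (V k).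
  rewrite rV rW; move: rH; have := rank_leq_row (H j k); have := rank_leq_col (H j k).
  by move: (\rank _) (\rank _) (\rank _) => r r' r''; lia.
have [d' dE] : exists d', d = nat_of d'.
  exists [ffun k => inord (d k)]; apply: boolp.funext => k.
  by rewrite /nat_of ffunE inordK // ltnS (leq_trans (dM k)) // (bigD1 k) //= leq_addr.
rewrite leNgt; apply/negP => lt; apply: good; right; exists d', I; rewrite -dE.
split=> //; rewrite /viol sI -ltz_nat PoszD !(big_morph Posz PoszD (erefl 0)) /=.
(* Since [d k <= m k], truncated subtraction agrees with subtraction of integers. *)
suff PoszMB (m : 'I_K -> nat) (P : pred 'I_K) : (forall k, d k <= m k)%N ->
    \sum_(k | P k) ((m k - d k) * d k)%:Z = \sum_(k | P k) ((m k)%:Z - (d k)%:Z) * (d k)%:Z.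
  by rewrite !PoszMB.
by move=> dm; apply: eq_bigr => k _; rewrite PoszM subzn.
Qed.
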